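(* Let $A,B\in\mathbb{R}^{n\times n}$ and let $\Omega\in\mathbb{R}^{n\times n}$ be a positive semi-definite matrix such that $A+\Omega$ is nonsingular. If $$\Vert(A+\Omega)^{-1}\Omega\Vert+\Vert(A+\Omega)^{-1}B\Vert<1,$$ then for any $b\in\mathbb{R}^n$ the equation $Ax-B|x|-b=0$ has a unique solution $x^*\in\mathbb{R}^n$, and the sequence $\{x^{(k)}\}_{k=0}^\infty$ generated by the MN iteration converges to $x^*$.
   Context: For $x\in\mathbb{R}^n$, $|x|$ is the componentwise absolute value. $\Vert\cdot\Vert$ is the matrix 2-norm. The MN (modified Newton-type) iteration starts from an arbitrary $x^{(0)}\in\mathbb{R}^n$ and is $x^{(k+1)}=(A+\Omega)^{-1}[\Omega x^{(k)}+B|x^{(k)}|+b]$, $k=0,1,2,\dots$. *)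

(* Defs.v *)
From HB Require Import structures.
From mathcomp Require Import all_boot all_order all_algebra.
From mathcomp Require Import all_classical all_reals all_analysis.

Set Implicit Arguments.
Unset Strict Implicit.
Unset Printing Implicit Defensive.

Import Order.TTheory GRing.Theory Num.Theory.
Import numFieldNormedType.Exports.

Local Open Scope classical_set_scope.
Local Open Scope ring_scope.

Definition absv (R : realType) (n : nat) (x : 'cV[R]_n) : 'cV[R]_n :=
  map_mx (fun t : R => `|t|) x.

(* The library norm `|x| on matrices is the entrywise maximum, hence the
   explicit Euclidean norm. *)
Definition norm2v (R : realType) (n : nat) (x : 'cV[R]_n) : R :=
  Num.sqrt (\sum_(i < n) x i 0 ^+ 2).

(* Operator norm induced by the Euclidean norm. The set is nonempty (x = 0) and
   bounded, so [sup] is a genuine supremum. *)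
Definition norm2mx (R : realType) (n : nat) (M : 'M[R]_n) : R :=
  sup [set norm2v (M *m x) | x in [set x : 'cV[R]_n | norm2v x <= 1]].

(* Symmetry is not part of the definition. *)
Definition psdmx (R : realType) (n : nat) (M : 'M[R]_n) : Prop :=
  forall x : 'cV[R]_n, 0 <= (x^T *m M *m x) 0 0.

Fixpoint MN_iter (R : realType) (n : nat) (A B Omega : 'M[R]_n)
    (b x0 : 'cV[R]_n) (k : nat) : 'cV[R]_n :=
  if k is k'.+1 then
    let x := MN_iter A B Omega b x0 k' in
    invmx (A + Omega) *m (Omega *m x + B *m absv x + b)
  else x0.

(* Main.v *)
Require Import Defs.
From HB Require Import structures.
From mathcomp Require Import all_boot all_order all_algebra.
From mathcomp Require Import all_classical all_reals all_analysis.
From mathcomp Require Import ring lra.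

(** Put [f x := (A + Omega)^-1 (Omega x + B |x| + b)].  Multiplying by the
    invertible matrix [A + Omega] shows that [x] solves [A x - B |x| - b = 0]
    exactly when [f x = x], and the iteration is by construction the sequence
    of iterates of [f].  Since [x |-> |x|] does not increase Euclidean
    distances, the triangle inequality and the bound
    [||M x|| <= ||M|| ||x||] show that [f] is Lipschitz for the Euclidean
    norm, with the constant
    [||(A + Omega)^-1 Omega|| + ||(A + Omega)^-1 B||], which is less than 1
    ([MN_map_lipschitz]).  The theorem is then the contraction principle
    for the Euclidean norm ([norm2v_contraction_principle]).

    The topology on matrices comes from the entrywise maximum norm, for which
    [f] itself need not be a contraction.  The two norms are equivalent
    ([mx_norm_le_norm2v], [norm2v_le_mx_norm]), so a large enough iterate of
    [f] contracts the maximum norm, and Banach's theorem applies to that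
    iterate.  Its fixed point is unique, hence also fixed by [f]; the geometric
    decay of the Euclidean distances to it then gives the convergence of all
    the iterates. *)

Set Implicit Arguments.
Unset Strict Implicit.
Unset Printing Implicit Defensive.

Import Order.TTheory GRing.Theory Num.Theory.
Import numFieldNormedType.Exports.

Local Open Scope classical_set_scope.
Local Open Scope ring_scope.

(** Banach's theorem is stated for complete normed modules; completeness and
    norm exist separately on matrices, and this joins them. *)
HB.instance Definition _ (R : realType) (m n : nat) :=
  Uniform_isComplete.Build 'M[R]_(m, n) cauchy_cvg.

(** * The Euclidean norm *)

Section EuclideanNorm.
Variables (R : realType) (n : nat).
Implicit Types (x y : 'cV[R]_n) (M : 'M[R]_n).

Lemma norm2v_ge0 x : 0 <= norm2v x.
Proof. exact: sqrtr_ge0. Qed.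

Lemma norm2v_sqr x : norm2v x ^+ 2 = \sum_(i < n) x i 0 ^+ 2.
Proof. by rewrite sqr_sqrtr// sumr_ge0// => i _; exact: sqr_ge0. Qed.

Lemma mx_entry_le_norm x i : `|x i 0| <= `|x|.
Proof.
rewrite [leRHS]/Num.Def.normr/= mx_normrE.
exact: (@le_bigmax _ _ _ _ (fun ij : 'I_n * 'I_1 => `|x ij.1 ij.2|) (i, 0)).
Qed.

Lemma mx_entry_le_norm2v x i : `|x i 0| <= norm2v x.
Proof.
rewrite -sqrtr_sqr ler_wsqrtr// (bigD1 i)//= lerDl sumr_ge0// => j _.
exact: sqr_ge0.
Qed.

Lemma mx_norm_le_norm2v x : `|x| <= norm2v x.
Proof.
rewrite [leLHS]/Num.Def.normr/= mx_normrE bigmax_le ?norm2v_ge0//= => -[i j] _.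
by rewrite ord1 mx_entry_le_norm2v.
Qed.

Lemma norm2v_le_mx_norm x : norm2v x <= Num.sqrt n%:R * `|x|.
Proof.
rewrite -(@ger0_norm _ `|x|)// -sqrtr_sqr -sqrtrM ?ler0n// ler_wsqrtr//.
rewrite mulr_natl -[X in _ *+ X]card_ord -sumr_const ler_sum// => i _.
by rewrite -[leLHS]real_normK ?num_real// lerXn2r ?nnegrE// mx_entry_le_norm.
Qed.

Lemma norm2v_eq0 x : norm2v x = 0 -> x = 0.
Proof.
by move=> x0; apply/eqP; rewrite -normr_le0 -x0 mx_norm_le_norm2v.
Qed.

Lemma norm2v0 : norm2v (0 : 'cV[R]_n) = 0.
Proof. by rewrite /norm2v big1 ?sqrtr0// => i _; rewrite mxE expr0n. Qed.

Lemma norm2vZ c x : norm2v (c *: x) = `|c| * norm2v x.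
Proof.
rewrite /norm2v -sqrtr_sqr -sqrtrM ?sqr_ge0// mulr_sumr.
by congr Num.sqrt; apply: eq_bigr => i _; rewrite mxE exprMn.
Qed.

(** The Cauchy-Schwarz inequality, obtained by expanding
    [0 <= ||b x - a y||^2] for [a = ||x||] and [b = ||y||]. *)
Lemma dot_le_norm2v x y : \sum_(i < n) x i 0 * y i 0 <= norm2v x * norm2v y.
Proof.
have [/norm2v_eq0 ->|x0] := eqVneq (norm2v x) 0.
  by rewrite norm2v0 mul0r big1// => i _; rewrite mxE mul0r.
have [/norm2v_eq0 ->|y0] := eqVneq (norm2v y) 0.
  by rewrite norm2v0 mulr0 big1// => i _; rewrite mxE mulr0.
set a := norm2v x; set b := norm2v y; set d := \sum_(i < n) _.
have ab_gt0 : 0 < a * b by rewrite mulr_gt0// lt_def norm2v_ge0 andbT.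
rewrite -(ler_pM2l ab_gt0).
have : 0 <= \sum_(i < n) (b * x i 0 - a * y i 0) ^+ 2.
  by apply: sumr_ge0 => i _; exact: sqr_ge0.
have -> : \sum_(i < n) (b * x i 0 - a * y i 0) ^+ 2
          = b ^+ 2 * a ^+ 2 + a ^+ 2 * b ^+ 2 - 2 * (a * b) * d.
  rewrite [a ^+ 2 in X in X + _ - _]norm2v_sqr.
  rewrite [b ^+ 2 in X in _ + X - _]norm2v_sqr.
  rewrite !mulr_sumr -big_split -sumrB /=.
  by apply: eq_bigr => i _; ring.
nra.
Qed.

Lemma ler_norm2vD x y : norm2v (x + y) <= norm2v x + norm2v y.
Proof.
rewrite -[leRHS]ger0_norm ?addr_ge0 ?norm2v_ge0// -[leRHS]sqrtr_sqr.
rewrite ler_wsqrtr//.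
have -> : \sum_(i < n) (x + y) i 0 ^+ 2 = norm2v x ^+ 2 + norm2v y ^+ 2
    + 2 * \sum_(i < n) x i 0 * y i 0.
  rewrite !norm2v_sqr mulr_sumr -!big_split /=.
  by apply: eq_bigr => i _; rewrite mxE; ring.
have := dot_le_norm2v x y; nra.
Qed.

Lemma norm2v_absvB x y : norm2v (absv x - absv y) <= norm2v (x - y).
Proof.
rewrite ler_wsqrtr// ler_sum// => i _; rewrite !mxE.
rewrite -[leLHS]real_normK ?num_real// -[leRHS]real_normK ?num_real//.
by rewrite lerXn2r ?nnegrE// ler_dist_dist.
Qed.

(** * The induced operator norm *)

(** The supremum defining [norm2mx M] is over a bounded set: on the unit ball
    every entry of [M *m x] is at most the sum of all the [`|M i j|]. *)
Lemma norm2mx_has_ubound M :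
  has_ubound [set norm2v (M *m x) | x in [set x : 'cV[R]_n | norm2v x <= 1]].
Proof.
exists (Num.sqrt n%:R * \sum_(i < n) \sum_(j < n) `|M i j|) => _ [x x1 <-].
apply: (le_trans (norm2v_le_mx_norm _)); rewrite ler_wpM2l ?sqrtr_ge0//.
have sum_ge0 i : 0 <= \sum_(j < n) `|M i j| by rewrite sumr_ge0.
rewrite [leLHS]/Num.Def.normr/= mx_normrE bigmax_le ?sumr_ge0//= => -[i k] _.
rewrite ord1 mxE [leRHS](bigD1 i)//=.
apply: (@le_trans _ _ (\sum_(j < n) `|M i j|)); last by rewrite lerDl sumr_ge0.
rewrite (le_trans (ler_norm_sum _ _ _))// ler_sum// => j _.
by rewrite normrM ler_piMr// (le_trans (mx_entry_le_norm2v _ _)).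
Qed.

Lemma norm2v_mulmx_le M x : norm2v (M *m x) <= norm2mx M * norm2v x.
Proof.
have [/norm2v_eq0 ->|x0] := eqVneq (norm2v x) 0.
  by rewrite mulmx0 norm2v0 mulr0.
have x_gt0 : 0 < norm2v x by rewrite lt_def x0 norm2v_ge0.
have normV : `|(norm2v x)^-1| = (norm2v x)^-1.
  by rewrite ger0_norm ?invr_ge0 ?ltW.
rewrite -ler_pdivrMr// mulrC -normV -norm2vZ scalemxAr.
apply: (ub_le_sup (norm2mx_has_ubound M)); exists ((norm2v x)^-1 *: x) => //=.
by rewrite norm2vZ normV mulVf.
Qed.

Lemma norm2mx_ge0 M : 0 <= norm2mx M.
Proof.
apply: (ub_le_sup (norm2mx_has_ubound M)); exists 0 => /=.
  by rewrite norm2v0.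
by rewrite mulmx0 norm2v0.
Qed.

End EuclideanNorm.

(** * The contraction principle for the Euclidean norm *)

Section Contraction.
Variables (R : realType) (n : nat) (f : 'cV[R]_n -> 'cV[R]_n) (q : R).
Hypotheses (q_ge0 : 0 <= q) (q_lt1 : q < 1).
Hypothesis f_lip : forall x y, norm2v (f x - f y) <= q * norm2v (x - y).

Lemma norm2v_iter_lipschitz k x y :
  norm2v (iter k f x - iter k f y) <= q ^+ k * norm2v (x - y).
Proof.
elim: k => [|k IHk]; first by rewrite expr0 mul1r.
by rewrite !iterS exprS -mulrA (le_trans (f_lip _ _))// ler_wpM2l.
Qed.

Lemma norm2v_contraction_fixpoint_unique x y : f x = x -> f y = y -> x = y.
Proof.
move=> fx fy; apply/eqP; rewrite -subr_eq0; apply/eqP/norm2v_eq0.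
have := f_lip x y; rewrite fx fy; have := norm2v_ge0 (x - y).
by move: q_lt1; nra.
Qed.

(** The norm equivalence costs a factor [sqrt n], absorbed by [q ^+ N]. *)
Lemma iter_mx_norm_contraction : exists N, exists2 c : {nonneg R},
  c%:num < 1 &
  forall x y, `|iter N f x - iter N f y| <= c%:num * `|x - y|.
Proof.
have qn0 : Num.sqrt n%:R * q ^+ k @[k --> \oo] --> (0 : R).
  by rewrite -[X in _ --> X](mulr0 (Num.sqrt n%:R)); apply: cvgMr;
    apply: cvg_expr; rewrite ger0_norm.
have [N _ /(_ N (leqnn N))/= qN_lt1] :=
  (cvgrPdist_lt _ _).1 qn0 _ (@ltr01 R).
have c_ge0 : 0 <= Num.sqrt n%:R * q ^+ N by rewrite mulr_ge0 ?exprn_ge0.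
exists N, (NngNum c_ge0) => [|x y] /=.
  by move: qN_lt1; rewrite sub0r normrN ger0_norm.
apply: (le_trans (mx_norm_le_norm2v _)).
apply: (le_trans (norm2v_iter_lipschitz _ _ _)).
by rewrite mulrAC [leRHS]mulrC ler_wpM2l ?exprn_ge0// norm2v_le_mx_norm.
Qed.

(** An iterate [g] of [f] has a unique fixed point [p]; since [f] commutes
    with [g], [f p] is fixed by [g] as well, so [f p = p]. *)
Lemma norm2v_contraction_fixpoint : exists x, f x = x.
Proof.
have [N [c c_lt1 fN_lip]] := iter_mx_norm_contraction.
pose g := iter N f.
have g_fun : set_fun setT setT g by [].
pose gF : {fun [set: 'cV[R]_n] >-> [set: 'cV[R]_n]} := mkfun_fun g_fun.
have g_contr : is_contraction gF.
  by exists c; split=> // -[x y] _; exact: fN_lip.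
have [|p _ gp] := banach_fixed_point g_contr closedT; first by exists 0.
exists p; apply: (contraction_fixpoint_unique g_contr) => //.
change (f p = iter N f (f p)).
by rewrite -iterSr iterS -[iter N f p]gp.
Qed.

Theorem norm2v_contraction_principle : exists xs, [/\ f xs = xs,
  forall x, f x = x -> x = xs
  & forall x0, iter k f x0 @[k --> \oo] --> xs].
Proof.
have [xs fxs] := norm2v_contraction_fixpoint.
exists xs; split=> // [x fx|x0].
  exact: norm2v_contraction_fixpoint_unique.
have iter_xs k : iter k f xs = xs by elim: k => //= k ->.
apply/subr_cvg0/norm_cvg0P.
apply: (@squeeze_cvgr _ _ _ _ (fun=> 0) (fun k => q ^+ k * norm2v (x0 - xs))).
- apply: nearW => k; rewrite normr_ge0/= -{1}(iter_xs k).
  exact: le_trans (mx_norm_le_norm2v _) (norm2v_iter_lipschitz _ _ _).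
- exact: cvg_cst.
- rewrite -[X in _ --> X](mul0r (norm2v (x0 - xs))); apply: cvgMl.
  by apply: cvg_expr; rewrite ger0_norm.
Qed.

End Contraction.

(** * The Newton-type iteration *)

Section MNMap.
Variables (R : realType) (n : nat) (A B Omega : 'M[R]_n) (b : 'cV[R]_n).

Definition MN_map (x : 'cV[R]_n) : 'cV[R]_n :=
  invmx (A + Omega) *m (Omega *m x + B *m absv x + b).

Lemma MN_iterE x0 k : MN_iter A B Omega b x0 k = iter k MN_map x0.
Proof. by elim: k => //= k ->. Qed.

Lemma MN_map_fixpointP x : A + Omega \in unitmx ->
  MN_map x = x <-> A *m x - B *m absv x - b = 0.
Proof.
move=> AO_unit.
have -> : A *m x - B *m absv x - b
    = (A + Omega) *m x - (Omega *m x + B *m absv x + b).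
  by rewrite mulmxDl !opprD !addrA addrK.
split=> [{1}<-|/eqP]; first by rewrite mulKVmx// subrr.
by rewrite subr_eq0 /MN_map => /eqP <-; rewrite mulKmx.
Qed.

Lemma MN_map_lipschitz x y : norm2v (MN_map x - MN_map y) <=
  (norm2mx (invmx (A + Omega) *m Omega) + norm2mx (invmx (A + Omega) *m B))
  * norm2v (x - y).
Proof.
have -> : MN_map x - MN_map y = (invmx (A + Omega) *m Omega) *m (x - y)
    + (invmx (A + Omega) *m B) *m (absv x - absv y).
  rewrite -!mulmxA -mulmxDr -mulmxBr; congr (_ *m _).
  by rewrite !mulmxBr opprD addrACA subrr addr0 opprD addrACA.
apply: (le_trans (ler_norm2vD _ _)); rewrite mulrDl lerD ?norm2v_mulmx_le//.
apply: (le_trans (norm2v_mulmx_le _ _)).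
by rewrite ler_wpM2l ?norm2mx_ge0 ?norm2v_absvB.
Qed.

End MNMap.

Theorem corollary4 (R : realType) (n : nat) (A B Omega : 'M[R]_n)
    (Omega_psd : psdmx Omega)
    (AOmega_unit : A + Omega \in unitmx)
    (norm_lt1 : norm2mx (invmx (A + Omega) *m Omega)
                + norm2mx (invmx (A + Omega) *m B) < 1) :
  forall b : 'cV[R]_n,
    exists xs : 'cV[R]_n,
      [/\ A *m xs - B *m absv xs - b = 0,
          forall x : 'cV[R]_n, A *m x - B *m absv x - b = 0 -> x = xs
        & forall x0 : 'cV[R]_n,
            MN_iter A B Omega b x0 k @[k --> \oo] --> xs].
Proof.
move=> b.
have [xs [fxs xs_uniq xs_cvg]] := norm2v_contraction_principle
  (addr_ge0 (norm2mx_ge0 _) (norm2mx_ge0 _)) norm_lt1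
  (MN_map_lipschitz A B Omega b).
exists xs; split=> [|x /(MN_map_fixpointP B b x AOmega_unit)|x0].
- exact/(MN_map_fixpointP B b xs AOmega_unit).
- exact: xs_uniq.
- by under eq_fun do rewrite MN_iterE; exact: xs_cvg.
Qed.
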